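(* Let $X$, $U$ be Banach spaces, let $\mathcal{U}$ be an input space as described in the context, let $A$ be the generator of a $C_0$-semigroup $(T(t))_{t\ge 0}$ on $X$, and let $F:X\times U\to X$ be a nonlinear operator as described in the context. Then the following statements on the semi-linear system $\Sigma(A,F)$ are equivalent: 1. $\Sigma(A,F)$ is semi-uniformly ISS. 2. $\Sigma(A,F)$ is UGS and has the semi-uniform limit property. 3. $\Sigma(A,F)$ is UGS and has the semi-uniform asymptotic gain property.
   Context: Comparison functions, with $\mathbb{R}_+=[0,\infty)$: $\mathcal{K}$ is the set of continuous strictly increasing $\mu:\mathbb{R}_+\to\mathbb{R}_+$ with $\mu(0)=0$; $\mathcal{K}_\infty$ is the set of unbounded $\mu\in\mathcal{K}$; $\mathcal{L}$ is the set of continuous strictly decreasing $\mu:\mathbb{R}_+\to\mathbb{R}_+$ with $\lim_{t\to\infty}\mu(t)=0$; $\mathcal{KL}$ is the set of continuous $\kappa:\mathbb{R}_+\times\mathbb{R}_+\to\mathbb{R}_+$ with $\kappa(\cdot,t)\in\mathcal{K}$ for all $t\ge0$ and $\kappa(r,\cdot)\in\mathcal{L}$ for all $r>0$. Setting. $X$ and $U$ are Banach spaces with norms $\|\cdot\|$ and $\|\cdot\|_U$. $\mathcal{U}$ is a normed vector space, with norm $\|\cdot\|_{\mathcal U}$, contained in the space $L^1_{\mathrm{loc}}(\mathbb{R}_+,U)$ of locally integrable functions, such that for all $u\in\mathcal{U}$ and $\tau\ge 0$ one has $u(\cdot+\tau)\in\mathcal{U}$ and $\|u(\cdot+\tau)\|_{\mathcal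 U}\le\|u\|_{\mathcal U}$. $A$ with domain $D(A)$ generates a $C_0$-semigroup $(T(t))_{t\ge0}$ on $X$; the graph norm is $\|x\|_A:=\|x\|+\|Ax\|$ for $x\in D(A)$. $F:X\times U\to X$ is such that for every $\tau>0$, $f\in C([0,\tau],X)$, $g\in\mathcal{U}$, the map $t\mapsto F(f(t),g(t))$ is integrable on $[0,\tau]$. The system $\Sigma(A,F)$ is $\dot x(t)=Ax(t)+F(x(t),u(t))$, $t\ge0$, $x(0)=x_0\in X$, with $u\in\mathcal{U}$. A mild solution on $\mathbb{R}_+$ is $x\in C(\mathbb{R}_+,X)$ with $x(t)=T(t)x_0+\int_0^tT(t-s)F(x(s),u(s))\,\mathrm{d}s$ for all $t\ge0$ (Bochner integral). Definitions. $\Sigma(A,F)$ is forward complete if for all $x_0\in X$ and $u\in\mathcal{U}$ there is a unique mild solution on $\mathbb{R}_+$, denoted $\phi(\cdot,x_0,u)$. $\Sigma(A,F)$ is uniformly globally stable (UGS) if it is forward complete and there exist $\gamma,\mu\in\mathcal{K}_\infty$ such that $\|\phi(t,x_0,u)\|\le\gamma(\|x_0\|)+\mu(\|u\|_{\mathcal U})$ for all $x_0\in X$, $u\in\mathcal{U}$, $t\ge0$. $\Sigma(A,F)$ is semi-uniformly input-to-state stable (semi-uniformly ISS) if it is UGS and there exist $\kappa\in\mathcal{KL}$ and $\mu\in\mathcal{K}_\infty$ such that $\|\phi(t,x_0,u)\|\le\kappa(\|x_0\|_A,t)+\mu(\|u\|_{\mathcal U})$ for all $x_0\in D(A)$, $u\in\mathcal{U}$,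 $t\ge0$. A forward complete $\Sigma(A,F)$ has the semi-uniform limit property if there exists $\mu\in\mathcal{K}_\infty$ such that for all $\varepsilon,r>0$ there is $\tau=\tau(\varepsilon,r)<\infty$ such that for all $x_0\in D(A)$ with $\|x_0\|_A\le r$ and all $u\in\mathcal{U}$ there exists $t\in[0,\tau]$ with $\|\phi(t,x_0,u)\|\le\varepsilon+\mu(\|u\|_{\mathcal U})$. A forward complete $\Sigma(A,F)$ has the semi-uniform asymptotic gain property if there exists $\mu\in\mathcal{K}_\infty$ such that for all $\varepsilon,r>0$ there is $\tau=\tau(\varepsilon,r)<\infty$ such that for all $x_0\in D(A)$ with $\|x_0\|_A\le r$, all $u\in\mathcal{U}$ and all $t\ge\tau$, $\|\phi(t,x_0,u)\|\le\varepsilon+\mu(\|u\|_{\mathcal U})$. *)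

(* Defs.v *)
From HB Require Import structures.
From mathcomp Require Import all_boot all_order all_algebra.
From mathcomp Require Import all_classical all_reals all_analysis.
Set Implicit Arguments.
Unset Strict Implicit.
Unset Printing Implicit Defensive.
Import Order.TTheory GRing.Theory Num.Theory.
Import numFieldNormedType.Exports.
Local Open Scope classical_set_scope.
Local Open Scope ring_scope.

(** * Comparison functions

A function on R_+ is a total function on [R] of which only the restriction to
[`[0, +oo[] is ever used. *)

Section comparison_functions.
Variable R : realType.
Implicit Types (mu : R -> R) (r s t M : R).

Definition class_K (mu : R -> R) : Prop :=
  [/\ {within `[0, +oo[, continuous mu},
      forall r, 0 <= r -> 0 <= mu r,
      forall r s, 0 <= r -> r < s -> mu r < mu s
    & mu 0 = 0].

Definition class_Koo (mu : R -> R) : Prop :=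
  class_K mu /\ forall M, exists2 r, 0 <= r & M < mu r.

Definition class_L (mu : R -> R) : Prop :=
  [/\ {within `[0, +oo[, continuous mu},
      forall t, 0 <= t -> 0 <= mu t,
      forall s t, 0 <= s -> s < t -> mu t < mu s
    & mu t @[t --> +oo] --> 0].

Definition class_KL (kappa : R -> R -> R) : Prop :=
  [/\ {within `[0, +oo[ `*` `[0, +oo[,
        continuous (fun p : R * R => kappa p.1 p.2)},
      forall t, 0 <= t -> class_K (kappa ^~ t)
    & forall r, 0 < r -> class_L (kappa r)].

End comparison_functions.

(** * The Bochner integral *)

Section bochner.
Context d (S : measurableType d) (R : realType).
Variables (mu : {measure set S -> \bar R}) (E : normedModType R).
Implicit Types (D : set S) (f s : S -> E).

Definition simple_integrable D s : Prop :=
  [/\ finite_set (range s),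
      forall v, measurable (s @^-1` [set v])
    & forall v, v != 0 -> (mu (D `&` s @^-1` [set v]) < +oo)%E].

Definition simple_integral D s : E :=
  \sum_(v \in [set: E]) fine (mu (D `&` s @^-1` [set v])) *: v.

Definition strongly_measurable D f : Prop :=
  exists2 s : nat -> S -> E, forall n, simple_integrable D (s n)
    & {ae mu, forall t, D t -> s n t @[n --> \oo] --> f t}.

(* [f] is not assumed to be measurable here; when it is strongly measurable,
   the integrand below is almost everywhere equal to a measurable function, so
   that its library integral is the usual one. *)
Definition bochner_approx D f (s : nat -> S -> E) : Prop :=
  (forall n, simple_integrable D (s n)) /\
  (\int[mu]_(t in D) `|f t - s n t|%:E)%E @[n --> \oo] --> 0%E.

Definition bochner_integrable D f : Prop :=
  strongly_measurable D f /\ exists s : nat -> S -> E, bochner_approx D f s.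

(* [f] is Bochner integrable on [D], with integral [v]. *)
Definition has_bochner_integral D f (v : E) : Prop :=
  strongly_measurable D f /\
  exists2 s : nat -> S -> E, bochner_approx D f s
    & simple_integral D (s n) @[n --> \oo] --> v.

End bochner.

(** * Semilinear systems

Real scalars lose no generality: a complex Banach space is a real one with the
same norm, and [C_0]-semigroups, generators and mild solutions are unchanged. *)

Section semigroup.
Variables (R : realType) (X : completeNormedModType R).
Implicit Types (s t h : R) (x y : X).

Definition C0_semigroup (T : R -> {linear X -> X}) : Prop :=
  [/\ forall t, 0 <= t -> continuous (T t),
      forall x, T 0 x = x,
      forall s t x, 0 <= s -> 0 <= t -> T (s + t) x = T s (T t x)
    & forall x, T t x @[t --> 0^'+] --> x].

(* The values of [A] outside [DA] are junk. *)
Definition generates (DA : set X) (A : X -> X) (T : R -> {linear X -> X}) :=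
  forall x y, (DA x /\ A x = y) <->
    (h^-1 *: (T h x - x) @[h --> 0^'+] --> y).

Definition graph_norm (A : X -> X) (x : X) : R := `|x| + `|A x|.

End semigroup.

Section input_space.
Variables (R : realType) (U : completeNormedModType R).
Implicit Types t tau : R.

Definition ae_eq_Rplus (f g : R -> U) : Prop :=
  {ae @lebesgue_measure R, forall t, 0 <= t -> f t = g t}.

Definition L1loc (f : R -> U) : Prop :=
  forall tau, 0 < tau -> bochner_integrable (@lebesgue_measure R) `[0, tau] f.

(* Elements of L^1_loc(R_+, U) are classes of functions modulo a.e. equality.
   The normed space [V] is contained in it through [rep], which picks a
   representative of each element. *)
Record input_space (V : normedModType R) (rep : V -> R -> U) : Prop := {
  rep_L1loc : forall u, L1loc (rep u) ;
  rep_linear : forall (a : R) u v,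
    ae_eq_Rplus (rep (a *: u + v)) (fun t => a *: rep u t + rep v t) ;
  rep_inj : forall u v, ae_eq_Rplus (rep u) (rep v) -> u = v ;
  rep_shift : forall u tau, 0 <= tau ->
    exists2 v, ae_eq_Rplus (rep v) (fun t => rep u (t + tau)) & `|v| <= `|u|
}.

End input_space.

Section system.
Variables (R : realType) (X U : completeNormedModType R) (V : normedModType R).
Variables (rep : V -> R -> U) (T : R -> {linear X -> X}).
Variables (DA : set X) (A : X -> X) (F : X * U -> X).
Implicit Types (u : V) (s t tau eps r : R).
Implicit Types (gamma mu : R -> R) (kappa : R -> R -> R).

Definition admissible_nonlinearity : Prop :=
  forall (tau : R) (f : R -> X) (g : V), 0 < tau ->
    {within `[0, tau], continuous f} ->
    bochner_integrable (@lebesgue_measure R) `[0, tau]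
      (fun t => F (f t, rep g t)).

Definition mild_solution (x0 : X) (u : V) (x : R -> X) : Prop :=
  {within `[0, +oo[, continuous x} /\
  forall t, 0 <= t ->
    exists2 I, has_bochner_integral (@lebesgue_measure R) `[0, t]
                 (fun s => T (t - s) (F (x s, rep u s))) I
      & x t = T t x0 + I.

Definition forward_complete : Prop := forall x0 u,
  (exists x, mild_solution x0 u x) /\
  (forall x y, mild_solution x0 u x -> mild_solution x0 u y ->
    forall t, 0 <= t -> x t = y t).

(* Meaningful at times [t >= 0] and under [forward_complete]. *)
Definition phi (t : R) (x0 : X) (u : V) : X :=
  xget (fun=> 0) [set x | mild_solution x0 u x] t.

Definition UGS : Prop := forward_complete /\
  exists gamma mu, [/\ class_Koo gamma, class_Koo mu
    & forall x0 u t, 0 <= t -> `|phi t x0 u| <= gamma `|x0| + mu `|u|].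

Definition semi_uniformly_ISS : Prop := UGS /\
  exists kappa mu, [/\ class_KL kappa, class_Koo mu
    & forall x0 u t, DA x0 -> 0 <= t ->
        `|phi t x0 u| <= kappa (graph_norm A x0) t + mu `|u|].

Definition semi_uniform_limit_property : Prop := forward_complete /\
  exists2 mu, class_Koo mu & forall eps r, 0 < eps -> 0 < r ->
    exists tau, forall x0 u, DA x0 -> graph_norm A x0 <= r ->
      exists t, [/\ 0 <= t, t <= tau & `|phi t x0 u| <= eps + mu `|u|].

Definition semi_uniform_asymptotic_gain_property : Prop := forward_complete /\
  exists2 mu, class_Koo mu & forall eps r, 0 < eps -> 0 < r ->
    exists tau, forall x0 u, DA x0 -> graph_norm A x0 <= r ->
      forall t, 0 <= t -> tau <= t -> `|phi t x0 u| <= eps + mu `|u|.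

End system.

(* Main.v *)
Require Import Defs.
From HB Require Import structures.
From mathcomp Require Import all_boot all_order all_algebra.
From mathcomp Require Import all_classical all_reals all_analysis.
From mathcomp Require Import measurable_realfun ring lra.
Import Order.TTheory GRing.Theory Num.Theory.
Import numFieldNormedType.Exports.
Local Open Scope classical_set_scope.
Local Open Scope ring_scope.

(** The implications 1 -> 2 -> 3 -> 1 are proved.

    1 -> 2.  For fixed [r], [kappa r t] tends to [0], so one time [t] with
    [kappa r t <= eps] serves all initial values of graph norm at most [r].

    2 -> 3.  At some time [s <= tau] the trajectory has norm at most
    [eps' + mu `|u|].  What follows is again a trajectory, that of the initial
    value [phi s x0 u] under the shifted input, which is no larger than [u]; so
    uniform global stability keeps it below
    [gamma (eps' + mu `|u|) + mu' `|u|] forever.  As [gamma (a + b)] is at most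
    [gamma (2 a)] or [gamma (2 b)], the part depending on [`|u|] splits off as a
    gain.

    This argument rests on the cocycle property ([phi_cocycle]), hence on a
    theory of the Bochner integral: the integral on [[0, t + t0]] in the mild
    formulation has to be cut at [t0], the first piece identified with [T t] of
    the integral at time [t0], and the second one translated.  Cutting needs
    uniqueness of the integral, which follows from
    [| simple_integral s - simple_integral s' | <= \int |s - s'|]
    ([simple_integral_dist]).  The integrands [|f - s|] need not be Borel
    measurable, as [f] is only an a.e. limit of simple functions; their
    integral, a supremum over the simple functions below, is then a lower
    integral.  It still ignores null sets ([lower_integral_setD_null]), and off
    a suitable null set [|f - s|] is measurable ([strongly_measurable_dist]).

    3 -> 1.  The excess [y] of a trajectory over the gains is at most [gamma r]
    and tends to [0] as [t] grows, uniformly for bounded [r], where [r] is the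
    graph norm of the initial value.  Any such family has a majorant in KL
    ([KL_majorant]): after division by a weight [w r] that grows faster than
    [gamma], the excess tends to [0] uniformly in all [r], so that
    [y <= w r * Sigma t] for a single [Sigma]; with [y <= gamma r] this gives
    [y <= sqrt (gamma r * w r * Sigma t)]. *)

Set Implicit Arguments.
Unset Strict Implicit.
Unset Printing Implicit Defensive.

(** * Lower integrals of nonnegative functions *)

Section lower_integral.
Context d (S : measurableType d) (R : realType).
Variable mu : {measure set S -> \bar R}.
Implicit Types (D N : set S) (f g : S -> \bar R).
Local Open Scope ereal_scope.
Import HBNNSimple.

(** Measurability of neither function is assumed: the integral of a nonnegative
    function is a supremum over the simple functions below it. *)
Lemma lower_integral_le D D' f g :
  (forall x, 0 <= f x) -> (forall x, 0 <= g x) -> D `<=` D' ->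
  (forall x, D x -> f x <= g x) ->
  \int[mu]_(x in D) f x <= \int[mu]_(x in D') g x.
Proof.
move=> f0 g0 DD' fg; rewrite integral_mkcond [leRHS]integral_mkcond.
rewrite !ge0_integralTE; last 2 first.
- by move=> x; apply: erestrict_ge0.
- by move=> x; apply: erestrict_ge0.
apply: le_ereal_sup => _ [h /= hf <-]; exists h => //= x.
apply: (le_trans (hf x)); rewrite !patchE.
case: ifPn => [/set_mem Dx|_]; first by rewrite mem_set ?fg//; exact: DD'.
by case: ifP => //.
Qed.

(** A simple function below [f] keeps its integral when it is set to [0] on [N],
    so that it may be compared with [f] restricted to the complement of [N]. *)
Lemma lower_integral_setD_null D N f : measurable N -> mu N = 0 ->
  (forall x, 0 <= f x) ->
  \int[mu]_(x in D) f x = \int[mu]_(x in D `\` N) f x.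
Proof.
move=> mN N0 f0; apply/eqP; rewrite eq_le; apply/andP; split; last first.
  by apply: lower_integral_le => // x [].
rewrite integral_mkcond ge0_integralTE; last first.
  by move=> x; apply: erestrict_ge0.
apply: ge_ereal_sup => _ [h /= hf <-].
have h0 x : 0 <= (h x)%:E by rewrite lee_fin.
rewrite -integralT_nnsfun (ge0_negligible_integral mN) ?setTD//; last first.
  by apply/measurable_EFinP; exact: measurable_funP.
rewrite integral_mkcond [leRHS]integral_mkcond.
apply: lower_integral_le => //= x; try by apply: erestrict_ge0.
move=> _; have := hf x; rewrite !patchE in_setC in_setD.
by case: (x \in D); case: (x \in N).
Qed.

Lemma lower_integral_ae_eq D f g :
  (forall x, 0 <= f x) -> (forall x, 0 <= g x) -> ae_eq mu D f g ->
  \int[mu]_(x in D) f x = \int[mu]_(x in D) g x.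
Proof.
move=> f0 g0 [N [mN N0 DN]].
rewrite (lower_integral_setD_null _ mN N0 f0).
rewrite (lower_integral_setD_null _ mN N0 g0).
apply: eq_integral => x; rewrite inE => -[Dx Nx].
by apply: contrapT => fgx; apply: Nx; apply: DN => /= /(_ Dx).
Qed.

End lower_integral.

(** * Simple functions and their integrals *)

Section simple_maps.
Context d (S : measurableType d).

(** The values lie in an arbitrary type because the finite partition on which
    two simple functions are both constant is the one of their pairing, see
    [simple_map_pair]. *)
Definition simple_map (J : choiceType) (p : S -> J) :=
  finite_set (range p) /\ forall j, measurable (p @^-1` [set j]).

Lemma simple_map_preimage (J : choiceType) (p : S -> J) (B : set J) :
  simple_map p -> measurable (p @^-1` B).
Proof.
move=> [finp mp].
have -> : p @^-1` B = \bigcup_(j in range p `&` B) p @^-1` [set j].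
  apply/seteqP; split=> [x Bx|x [j [_ Bj] /= pxj]].
    by exists (p x) => //; split => //; exists x.
  by rewrite /preimage/= pxj.
by apply: fin_bigcup_measurable => //; apply: finite_setIl.
Qed.

Lemma simple_map_pair (J K : choiceType) (p : S -> J) (q : S -> K) :
  simple_map p -> simple_map q -> simple_map (fun x => (p x, q x)).
Proof.
move=> [finp mp] [finq mq]; split=> [|[j k]].
  apply: (@sub_finite_set _ _ (range p `*` range q)); last exact: finite_setX.
  by move=> _ [x _ <-]; split; exists x.
have -> : (fun x => (p x, q x)) @^-1` [set (j, k)] =
    (p @^-1` [set j]) `&` (q @^-1` [set k]).
  by apply/seteqP; split=> x /= [-> ->].
exact: measurableI.
Qed.

Lemma simple_map_comp (J K : choiceType) (c : J -> K) (p : S -> J) :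
  simple_map p -> simple_map (c \o p).
Proof.
move=> sp; split=> [|k].
  by rewrite -(image_comp p c); apply: finite_image; exact: (proj1 sp).
by rewrite comp_preimage; exact: simple_map_preimage.
Qed.

End simple_maps.

Section simple_integrals.
Context d (S : measurableType d) (R : realType).
Variable mu : {measure set S -> \bar R}.
Implicit Types (D : set S).

Lemma fin_measureI D A : measurable D -> (mu D < +oo)%E -> measurable A ->
  mu (D `&` A) \is a fin_num.
Proof.
move=> mD Doo mA; rewrite ge0_fin_numE//.
apply: le_lt_trans Doo; apply: le_measure; rewrite ?inE//.
exact: measurableI.
Qed.

Lemma simple_integrableE (E : normedModType R) D (s : S -> E) : measurable D ->
  (mu D < +oo)%E -> simple_integrable mu D s <-> simple_map s.
Proof.
move=> mD Doo; split=> [[]//|[fs ms]]; split => // v _.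
by rewrite -ge0_fin_numE//; apply: fin_measureI.
Qed.

(** The integral may be computed on any partition finer than the level sets:
    the fibre of [c \o p] over [v] is the disjoint union of the fibres of [p]
    over the points that [c] sends to [v]. *)
Lemma simple_integral_comp (E : normedModType R) (J : choiceType) D
    (p : S -> J) (c : J -> E) :
  measurable D -> (mu D < +oo)%E -> simple_map p ->
  simple_integral mu D (c \o p) =
  \sum_(j \in range p) fine (mu (D `&` p @^-1` [set j])) *: c j.
Proof.
move=> mD Doo sp; have [finp mp] := sp.
pose m j := fine (mu (D `&` p @^-1` [set j])).
have mE j : mu (D `&` p @^-1` [set j]) = (m j)%:E.
  by rewrite fineK//; exact: fin_measureI.
have fincp : finite_set (range (c \o p)) by have [] := simple_map_comp c sp.
rewrite /simple_integral -(fsbig_widen (range (c \o p)) setT)//=; last first.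
  move=> v [_ /= nv]; rewrite (_ : _ `&` _ = set0) ?measure0 ?scale0r//.
  by rewrite -subset0 => x [_ /= cx]; apply: nv; exists x.
transitivity (\sum_(v \in range (c \o p)) \sum_(j \in range p)
    if c j == v then m j *: c j else 0).
  apply: eq_fsbigr => v _.
  have -> : mu (D `&` (c \o p) @^-1` [set v]) =
      (\sum_(j \in range p `&` c @^-1` [set v]) m j)%:E.
    rewrite -fsumEFin; last exact: finite_setIl.
    rewrite (_ : _ `&` _ = \bigcup_(j in range p `&` c @^-1` [set v])
       (D `&` p @^-1` [set j])); last first.
      apply/seteqP; split=> [x [Dx /= cx]|x [j [_ cj] [Dx /= pj]]].
        by exists (p x) => //; split => //; exists x.
      by split => //=; rewrite pj.
    rewrite measure_fin_bigcup//=; last 3 first.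
    - exact: finite_setIl.
    - by move=> i j _ _ [x [[_ /= <-] [_ /= <-]]].
    - by move=> j _; exact: measurableI.
    by apply: eq_fsbigr => j _; rewrite mE.
  rewrite /= fsbig_finite; last exact: finite_setIl.
  rewrite scaler_suml -fsbig_finite; last exact: finite_setIl.
  rewrite fsbig_mkcondr; apply: eq_fsbigr => j _.
  by case: ifPn => [/set_mem /= <-|/negP]; rewrite ?eqxx// => cv;
     case: eqP => // cjv; exfalso; apply: cv; rewrite inE.
rewrite exchange_fsbig//; apply: eq_fsbigr => j /set_mem [x _ <-].
rewrite (fsbigD1 (c (p x)))//=; last by exists x.
rewrite eqxx fsbig1 ?addr0// => v [_ /= vp].
by case: eqP => // cv; exfalso; apply: vp.
Qed.

Lemma lower_integral_simple (J : choiceType) D (p : S -> J) (c : J -> R) :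
  measurable D -> (mu D < +oo)%E -> simple_map p -> (forall j, 0 <= c j) ->
  (\int[mu]_(x in D) (c (p x))%:E)%E =
  (\sum_(j \in range p) fine (mu (D `&` p @^-1` [set j])) * c j)%:E.
Proof.
move=> mD Doo sp c0; have [finp mp] := sp.
have mE j : mu (D `&` p @^-1` [set j]) =
    (fine (mu (D `&` p @^-1` [set j])))%:E.
  by rewrite fineK//; exact: fin_measureI.
transitivity (\int[mu]_(x in D)
    (\sum_(j \in range p) (c j * \1_(p @^-1` [set j]) x)%:E))%E.
  apply: eq_integral => x _; rewrite fsumEFin//; congr EFin.
  rewrite (fsbigD1 (p x))//=; last by exists x.
  rewrite indicE mem_set//= mulr1 fsbig1 ?addr0// => j [_ /= jp].
  by rewrite indicE memNset ?mulr0// => /= pj; apply: jp.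
rewrite ge0_integral_fsum//; last 2 first.
- by move=> j; apply/measurable_EFinP; apply: measurable_funM => //.
- by move=> j x _; rewrite lee_fin mulr_ge0.
rewrite -fsumEFin//; apply: eq_fsbigr => j _.
rewrite (integralZl_indic _ (fun=> p @^-1` [set j]))//; last first.
  by move=> c0'; have := c0 j; rewrite leNgt c0'.
by rewrite integral_indic// setIC mE -EFinM mulrC.
Qed.

(** Both integrals are computed on the partition of the pairing [(s, s')], where
    the triangle inequality applies term by term. *)
Lemma simple_integral_dist (E : normedModType R) D (s s' : S -> E) :
  measurable D -> (mu D < +oo)%E -> simple_map s -> simple_map s' ->
  (`|simple_integral mu D s - simple_integral mu D s'|%:E <=
   \int[mu]_(x in D) `|s x - s' x|%:E)%E.
Proof.
move=> mD Doo ss ss'; have sp := simple_map_pair ss ss'.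
set p := fun x => _ in sp; have [finp _] := sp.
rewrite -[s in X in (X <= _)%E]/(fst \o p) -[s' in X in (X <= _)%E]/(snd \o p).
rewrite !simple_integral_comp//.
rewrite (lower_integral_simple
  (c := fun v : E * E => `|v.1 - v.2|) mD Doo sp)//.
rewrite lee_fin !fsbig_finite// -sumrB; apply: le_trans (ler_norm_sum _ _ _) _.
by apply: ler_sum => v _; rewrite -scalerBr normrZ ger0_norm.
Qed.

Lemma simple_integral_linear (E E' : normedModType R) (L : {linear E -> E'}) D
    (s : S -> E) : measurable D -> (mu D < +oo)%E -> simple_map s ->
  simple_integral mu D (L \o s) = L (simple_integral mu D s).
Proof.
move=> mD Doo ss; have [fins _] := ss.
rewrite simple_integral_comp// -[s in RHS]/(idfun \o s) simple_integral_comp//.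
rewrite !fsbig_finite// linear_sum; apply: eq_bigr => v _.
by rewrite linearZ.
Qed.

Lemma simple_integralU (E : normedModType R) D1 D2 (s : S -> E) :
  measurable D1 -> measurable D2 -> (mu D1 < +oo)%E -> (mu D2 < +oo)%E ->
  mu (D1 `&` D2) = 0%E -> simple_map s ->
  simple_integral mu (D1 `|` D2) s =
  simple_integral mu D1 s + simple_integral mu D2 s.
Proof.
move=> mD1 mD2 D1oo D2oo D0 ss; have [fins ms] := ss.
have Doo : (mu (D1 `|` D2) < +oo)%E.
  by rewrite measureUfinl// D0 sube0 lte_add_pinfty.
rewrite -[s]/(idfun \o s) !simple_integral_comp//; last exact: measurableU.
rewrite -fsbig_split//=; apply: eq_fsbigr => v _.
rewrite -scalerDl -fineD; try exact: fin_measureI.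
congr (fine _ *: _).
rewrite setIUl measureUfinl; try exact: measurableI; last first.
  by rewrite -ge0_fin_numE//; exact: fin_measureI.
rewrite [X in (_ - X)%E](_ : _ = 0%E) ?sube0//.
apply: subset_measure0 D0; [|exact: measurableI|by move=> x [[? _] []]].
by apply: measurableI; exact: measurableI.
Qed.

End simple_integrals.

(** * The Bochner integral *)

Lemma cvg_ext (I : Type) (G : set_system I) (Y : topologicalType) (f g : I -> Y)
  (l : Y) : f @ G --> l -> f =1 g -> g @ G --> l.
Proof. by move=> fl /funext <-. Qed.

Section bochner_integrals.
Context d (S : measurableType d) (R : realType).
Variable mu : {measure set S -> \bar R}.
Implicit Types (D N : set S).

Lemma measurable_simple_map D (p : S -> R) : simple_map p -> measurable_fun D p.
Proof.
move=> sp mD B mB; apply: measurableI => //; exact: simple_map_preimage.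
Qed.

Lemma measurable_simple_dist (E : normedModType R) D (s s' : S -> E) :
  simple_map s -> simple_map s' -> measurable_fun D (fun x => `|s x - s' x|).
Proof.
move=> ss ss'; apply: measurable_simple_map.
exact: (simple_map_comp (fun v : E * E => `|v.1 - v.2|)
         (simple_map_pair ss ss')).
Qed.

(** One null set [N] makes [|f - s|] measurable for all [s] simultaneously: off
    [N], [f] is a pointwise limit of simple functions [s n], and [|s n - s|] is
    itself simple. *)
Lemma strongly_measurable_dist (E : normedModType R) D (f : S -> E) :
  measurable D -> strongly_measurable mu D f ->
  exists N, [/\ measurable N, mu N = 0%E &
    forall s, simple_map s -> measurable_fun (D `\` N) (fun x => `|f x - s x|)].
Proof.
move=> mD [s ss [N [mN N0 DN]]]; exists N; split => // s' ss'.
apply: (measurable_fun_cvg (h := fun n x => `|s n x - s' x|)).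
  by move=> n; apply: measurable_simple_dist => //; have [] := ss n.
move=> x [Dx Nx]; apply: cvg_norm; apply: cvgB; last exact: cvg_cst.
apply: contrapT => sfx; apply: Nx; apply: DN => /= H.
exact: sfx (H Dx).
Qed.

Lemma bochner_approx_ae_eq (E : normedModType R) D (f g : S -> E)
    (s : nat -> S -> E) : ae_eq mu D f g ->
  bochner_approx mu D f s -> bochner_approx mu D g s.
Proof.
move=> fg [ss fs]; split => //.
rewrite [X in X @ _ --> _](_ : _ =
  fun n => (\int[mu]_(t in D) `|f t - s n t|%:E)%E)//.
apply/funext => n; apply: lower_integral_ae_eq => //.
by apply: filterS fg => x fgx Dx; rewrite fgx.
Qed.

Lemma strongly_measurable_ae_eq (E : normedModType R) D (f g : S -> E) :
  ae_eq mu D f g -> strongly_measurable mu D f -> strongly_measurable mu D g.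
Proof.
move=> fg [s ss sf]; exists s => //; apply: filterS2 fg sf => x fgx sfx Dx.
by rewrite -fgx//; exact: sfx.
Qed.

Lemma has_bochner_integral_ae_eq (E : normedModType R) D (f g : S -> E) I :
  ae_eq mu D f g ->
  has_bochner_integral mu D f I -> has_bochner_integral mu D g I.
Proof.
move=> fg [mf [s fs sI]]; split; first exact: strongly_measurable_ae_eq mf.
by exists s => //; exact: bochner_approx_ae_eq fs.
Qed.

Lemma bochner_approx_subset (E : normedModType R) D D' (f : S -> E)
    (s : nat -> S -> E) : measurable D' -> (mu D' < +oo)%E -> D' `<=` D ->
  bochner_approx mu D f s -> bochner_approx mu D' f s.
Proof.
move=> mD' D'oo D'D [ss fs]; split.
  by move=> n; apply/simple_integrableE => //; have [] := ss n.
apply: squeeze_cvge (cvg_cst 0%E) fs; apply: nearW => n.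
by rewrite integral_ge0//=; apply: lower_integral_le.
Qed.

Lemma strongly_measurable_subset (E : normedModType R) D D' (f : S -> E) :
  measurable D' -> (mu D' < +oo)%E -> D' `<=` D ->
  strongly_measurable mu D f -> strongly_measurable mu D' f.
Proof.
move=> mD' D'oo D'D [s ss sf]; exists s.
  by move=> n; apply/simple_integrableE => //; have [] := ss n.
by apply: filterS sf => x + D'x; apply; exact: D'D.
Qed.

(** Uniqueness of the Bochner integral, in the form used to transfer the limit
    of the integrals of one approximating sequence to another. *)
Lemma bochner_approx_unique (E : normedModType R) D (f : S -> E)
    (s s' : nat -> S -> E) : measurable D -> (mu D < +oo)%E ->
  strongly_measurable mu D f ->
  bochner_approx mu D f s -> bochner_approx mu D f s' ->
  simple_integral mu D (s n) - simple_integral mu D (s' n) @[n --> \oo] --> 0.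
Proof.
move=> mD Doo mf [ss fs] [ss' fs'].
have {}ss n : simple_map (s n) by have [] := ss n.
have {}ss' n : simple_map (s' n) by have [] := ss' n.
have [N [mN N0 mfN]] := strongly_measurable_dist mD mf.
have le n : (`|simple_integral mu D (s n) - simple_integral mu D (s' n)|%:E <=
    \int[mu]_(t in D) `|f t - s n t|%:E +
    \int[mu]_(t in D) `|f t - s' n t|%:E)%E.
  apply: le_trans (simple_integral_dist mD Doo (ss n) (ss' n)) _.
  rewrite !(lower_integral_setD_null D mN N0)//.
  rewrite -ge0_integralD//; last 3 first.
  - exact: measurableD.
  - by apply/measurable_EFinP; exact: mfN.
  - by apply/measurable_EFinP; exact: mfN.
  apply: lower_integral_le => // [x|x _]; rewrite -EFinD lee_fin ?addr_ge0//.
  by rewrite (distrC (f x) (s n x)); exact: ler_distD.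
have lim0 : (\int[mu]_(t in D) `|f t - s n t|%:E +
    \int[mu]_(t in D) `|f t - s' n t|%:E)%E @[n --> \oo] --> 0%E.
  by rewrite -[X in _ --> X](adde0 0%E); apply: cvgeD.
apply: norm_cvg0; have /fine_cvgP[] //= : `|simple_integral mu D (s n) -
    simple_integral mu D (s' n)|%:E @[n --> \oo] --> 0%E.
apply: squeeze_cvge (cvg_cst 0%E) lim0; apply: nearW => n.
by rewrite le lee_fin normr_ge0.
Qed.

Lemma has_bochner_integral_linear (E E' : normedModType R)
    (L : {linear E -> E'}) D (f : S -> E) I :
  measurable D -> (mu D < +oo)%E -> continuous L ->
  has_bochner_integral mu D f I -> has_bochner_integral mu D (L \o f) (L I).
Proof.
move=> mD Doo cL [mf [s [ss fs] sI]].
have sL s' : simple_map s' -> simple_integrable mu D (L \o s').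
  by move=> ?; apply/simple_integrableE => //; exact: simple_map_comp.
have [N [mN N0 mfN]] := strongly_measurable_dist mD mf.
have {}ss n : simple_map (s n) by have [] := ss n.
split.
  have [s' ss' sf'] := mf; exists (fun n => L \o s' n).
    by move=> n; apply: sL; have [] := ss' n.
  apply: filterS sf' => x + Dx => /(_ Dx) s'x.
  exact: (cvg_comp _ _ s'x (cL (f x))).
exists (fun n => L \o s n); last first.
  under eq_fun do rewrite simple_integral_linear//.
  exact: (cvg_comp _ _ sI (cL I)).
split; first by move=> n; exact: sL.
have /linear_bounded_continuous/linear_boundedP/pinfty_ex_gt0[k k0 Lk] := cL.
have lim0 : (k%:E * \int[mu]_(t in D) `|f t - s n t|%:E)%E
    @[n --> \oo] --> 0%E.
  by rewrite -[X in _ --> X](mule0 k%:E); apply: cvgeZl.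
apply: squeeze_cvge (cvg_cst 0%E) lim0; apply: nearW => n.
rewrite integral_ge0//= !(lower_integral_setD_null D mN N0)//.
rewrite -ge0_integralZl_EFin//; last 3 first.
- exact: measurableD.
- by apply/measurable_EFinP; exact: mfN.
- exact: ltW.
apply: lower_integral_le => // [x|x _]; rewrite -EFinM lee_fin.
  by rewrite mulr_ge0// ltW.
by rewrite /= -linearB.
Qed.

(** The sequence approximating [f] on the union approximates it on both pieces.
    Its integrals over [D1] tend to [I1] by uniqueness, hence those over [D2] to
    [I - I1]; in particular [f] is integrable on [D2]. *)
Lemma has_bochner_integral_setU (E : normedModType R) D1 D2 (f : S -> E) I I1 :
  measurable D1 -> measurable D2 -> (mu D1 < +oo)%E -> (mu D2 < +oo)%E ->
  mu (D1 `&` D2) = 0%E ->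
  has_bochner_integral mu (D1 `|` D2) f I -> has_bochner_integral mu D1 f I1 ->
  has_bochner_integral mu D2 f (I - I1).
Proof.
move=> mD1 mD2 D1oo D2oo D0 [mf [s fs sI]] [mf1 [s1 fs1 s1I]].
have D2D : D2 `<=` D1 `|` D2 by move=> x; right.
have D1D : D1 `<=` D1 `|` D2 by move=> x; left.
split; first exact: strongly_measurable_subset mf.
exists s; first exact: bochner_approx_subset fs.
have ss n : simple_map (s n) by have [+ _] := fs => /(_ n)[].
have sI1 : simple_integral mu D1 (s n) @[n --> \oo] --> I1.
  rewrite -[I1]add0r; apply: cvg_ext (cvgD (bochner_approx_unique mD1 D1oo mf1
    (bochner_approx_subset mD1 D1oo D1D fs) fs1) s1I) _ => n.
  exact: subrK.
apply: cvg_ext (cvgB sI sI1) _ => n.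
transitivity
  (simple_integral mu (D1 `|` D2) (s n) - simple_integral mu D1 (s n)).
  by [].
by rewrite simple_integralU// addrC addKr.
Qed.

Section measure_preserving.
Context d' (S' : measurableType d') (mu' : {measure set S' -> \bar R}).
Variable theta : S' -> S.
Hypothesis mtheta : measurable_fun setT theta.
Hypothesis theta_preserving : forall A, measurable A ->
  mu' (theta @^-1` A) = mu A.

Let mpre A : measurable A -> measurable (theta @^-1` A).
Proof. by move=> mA; rewrite -[_ @^-1` _]setTI; exact: mtheta. Qed.

Lemma ae_preimage (P : set S) : {ae mu, forall x, P x} ->
  {ae mu', forall x, P (theta x)}.
Proof.
move=> [N [mN N0 PN]]; exists (theta @^-1` N); split.
- exact: mpre.
- by rewrite theta_preserving.
- by move=> x /= nP; apply: PN.
Qed.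

(** The change of variables formula for measurable functions is applied to
    [|f - s n|] off a null set, which does not affect the lower integral. *)
Lemma has_bochner_integral_preimage (E : normedModType R) D (f : S -> E) I :
  measurable D -> (mu D < +oo)%E ->
  has_bochner_integral mu D f I ->
  has_bochner_integral mu' (theta @^-1` D) (f \o theta) I.
Proof.
move=> mD Doo [mf [s [ss fs] sI]].
have mD' := mpre mD.
have Doo' : (mu' (theta @^-1` D) < +oo)%E by rewrite theta_preserving.
have stheta s' : simple_map s' -> simple_map (s' \o theta : S' -> E).
  move=> [fs' ms']; split=> [|v]; last first.
    by rewrite comp_preimage; exact: mpre.
  by apply: sub_finite_set fs' => _ [x _ <-]; exists (theta x).
have [N [mN N0 mfN]] := strongly_measurable_dist mD mf.
split.
  have [s' ss' sf'] := mf; exists (fun n => s' n \o theta).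
    move=> n; apply/simple_integrableE => //; apply: stheta.
    by have [] := ss' n.
  exact: (ae_preimage sf').
have {}ss n : simple_map (s n) by have [] := ss n.
exists (fun n => s n \o theta); last first.
  apply: cvg_ext sI _ => n.
  apply: eq_fsbigr => v _; congr (fine _ *: _).
  rewrite comp_preimage -preimage_setI theta_preserving//.
  by apply: measurableI => //; have [] := ss n.
split; first by move=> n; apply/simple_integrableE => //; exact: stheta.
apply: cvg_ext fs _ => n.
rewrite (lower_integral_setD_null D mN N0)//.
rewrite (lower_integral_setD_null (theta @^-1` D) (mpre mN))//; last first.
  by rewrite theta_preserving.
have mDN : measurable (D `\` N) by exact: measurableD.
transitivity (\int[pushforward mu' theta]_(x in D `\` N) `|f x - s n x|%:E)%E.
  by apply: eq_measure_integral => A mA _; rewrite -theta_preserving.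
rewrite ge0_integral_pushforward//.
by apply/measurable_EFinP; exact: mfN.
Qed.

End measure_preserving.
End bochner_integrals.

(** * Translation of mild solutions *)

Lemma continuous_within_comp (X Y Z : topologicalType) (A : set X) (B : set Y)
    (h : X -> Y) (f : Y -> Z) :
  {within A, continuous h} -> (forall x, A x -> B (h x)) ->
  {within B, continuous f} -> {within A, continuous (f \o h)}.
Proof.
move=> /subspace_continuousP ch hAB /subspace_continuousP cf.
apply/subspace_continuousP => x Ax P /(cf _ (hAB _ Ax)) /= BP.
have := ch _ Ax _ BP; rewrite /= /nbhs/= /within /=.
by apply: filterS => y + Ay => /(_ Ay); apply; exact: hAB.
Qed.

Lemma lebesgue_measure_translation (R : realType) (c : R)
    (A : set (measurableTypeR R)) :
  measurable A ->
  lebesgue_measure ((fun x : R => x + c) @^-1` A) = lebesgue_measure A.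
Proof.
move=> mA.
have mc : measurable_fun setT ((fun x : R => x + c) : _ -> measurableTypeR R).
  exact: measurable_funD.
apply/esym.
rewrite -[RHS]/(pushforward lebesgue_measure
  ((fun x : R => x + c) : _ -> measurableTypeR R) A).
apply: lebesgue_measure_unique => //= _ [[a b]] _ <-.
rewrite /pushforward /=.
have -> : (fun x : R => x + c) @^-1` `]a, b]%classic = `]a - c, b - c]%classic.
  by apply/seteqP; split=> x /=; rewrite !in_itv/= ltrBlDr lerBrDr.
rewrite !lebesgue_measure_itv/= !lte_fin ltrD2r -!EFinD.
by rewrite (_ : b - c - (a - c) = b - a)//; ring.
Qed.

Section cocycle.
Variables (R : realType) (X U : completeNormedModType R) (V : normedModType R).
Variables (rep : V -> R -> U) (T : R -> {linear X -> X}) (F : X * U -> X).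
Hypothesis hT : C0_semigroup T.

(** The integral [I] at time [t + t0] is cut at [t0].  By the semigroup law its
    part over [[0, t0]] is [T t J], where [J] is the integral at time [t0]; the
    rest, translated by [t0], is the integral in the mild formulation for the
    initial value [x t0 = T t0 x0 + J]. *)
Lemma mild_solution_shift x0 u v t0 x : 0 <= t0 ->
  ae_eq_Rplus (rep v) (fun t => rep u (t + t0)) ->
  mild_solution rep T F x0 u x ->
  mild_solution rep T F (x t0) v (fun t => x (t + t0)).
Proof.
move=> t00 vu [cx xsol]; split.
  apply: (continuous_within_comp (h := fun t => t + t0)) cx.
    apply: continuous_subspaceT => t.
    by apply: cvgD; [exact: cvg_id|exact: cvg_cst].
  by move=> t /=; rewrite !in_itv/= !andbT => t_ge0; exact: addr_ge0.
have [cT T0 TD _] := hT.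
move=> t t_ge0.
have [I hI xI] := xsol _ (addr_ge0 t_ge0 t00).
have [J hJ xJ] := xsol _ t00.
exists (I - T t J); last first.
  by rewrite xI xJ linearD/= TD// addrACA subrr addr0.
have oo a b : (lebesgue_measure (`[a, b] : set R) < +oo)%E.
  rewrite lebesgue_measure_itv/=.
  by case: ifP => _; rewrite ?ltry -?EFinB ?ltry.
have mitv a b : measurable (`[a, b] : set (measurableTypeR R)).
  exact: measurable_itv.
have split_itv :
    `[0, t + t0]%classic = `[0, t0]%classic `|` `[t0, t + t0]%classic.
  apply/seteqP; split=> s /=; rewrite !in_itv/=.
    by move=> /andP[-> ->]; rewrite andbT; apply/orP; exact: le_total.
  by move=> [] /andP[? ?]; apply/andP; split; lra.
pose f s := T (t + t0 - s) (F (x s, rep u s)).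
have {}hJ : has_bochner_integral lebesgue_measure `[0, t0]%classic f (T t J).
  apply: has_bochner_integral_ae_eq
    (has_bochner_integral_linear (mitv 0 t0) (oo 0 t0) (cT t t_ge0) hJ).
  apply: aeW => s /=; rewrite in_itv/= => /andP[_ st0].
  by rewrite -TD ?subr_ge0// addrA.
have null : lebesgue_measure (`[0, t0]%classic `&` `[t0, t + t0]%classic) = 0%E.
  rewrite (_ : _ `&` _ = [set t0]) ?lebesgue_measure_set1//.
  apply/seteqP; split=> s /=; rewrite !in_itv/=.
    by move=> [/andP[_ ?] /andP[? _]]; apply/eqP; rewrite eq_le; apply/andP.
  by move=> ->; rewrite !lexx t00 lerDr.
rewrite split_itv in hI.
have hK := has_bochner_integral_setU (mitv _ _) (mitv _ _) (oo _ _) (oo _ _)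
  null hI hJ.
have mc : measurable_fun setT 
    ((fun s : R => s + t0) : measurableTypeR R -> measurableTypeR R).
  exact: measurable_funD.
have := has_bochner_integral_preimage
  (mu' := @lebesgue_measure R) mc
  (@lebesgue_measure_translation R t0) (mitv _ _) (oo _ _) hK.
have -> : (fun s => s + t0) @^-1` `[t0, t + t0]%classic = `[0, t]%classic.
  by apply/seteqP; split=> s /=; rewrite !in_itv/= lerD2r lerDr.
apply: has_bochner_integral_ae_eq; 
apply: (@filterS _ _ (ae_filter_ringOfSetsType (@lebesgue_measure R)) _ _ _ vu).
move=> s vus.
rewrite /= in_itv/= => /andP[s0 _]; rewrite vus// /f.
by rewrite (_ : t + t0 - (s + t0) = t - s)//; ring.
Qed.
End cocycle.

(** * Comparison functions *)

Section comparison.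
Variable R : realType.
Implicit Types (gamma mu f g : R -> R).

Lemma class_K_le gamma r s : class_K gamma -> 0 <= r -> r <= s ->
  gamma r <= gamma s.
Proof.
move=> [_ _ incr _] r0; rewrite le_eqVlt => /predU1P[->//|rs].
by rewrite ltW// incr.
Qed.

Lemma class_K_small gamma eps : class_K gamma -> 0 < eps ->
  exists2 delta, 0 < delta & gamma delta <= eps.
Proof.
move=> [/subspace_continuousP cg _ _ g0] eps0.
have /cvgrPdist_le/(_ _ eps0) : gamma x @[x --> within `[0, +oo[ (nbhs (0 : R))]
    --> gamma 0 by apply: cg => /=; rewrite in_itv/= lexx.
rewrite g0 => -[delta /= d0 hd].
exists (delta / 2); first by rewrite divr_gt0.
have : `|0 - gamma (delta / 2)| <= eps.
  apply: (hd (delta / 2)); rewrite /= ?in_itv/= ?andbT ?divr_ge0 ?ltW//.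
  by rewrite sub0r normrN gtr0_norm ?divr_gt0// ltr_pdivrMr// ltr_pMr// ltr1n.
by rewrite sub0r normrN; apply: le_trans; exact: ler_norm.
Qed.

Lemma class_Koo_add f g : class_Koo f -> class_Koo g ->
  class_Koo (fun r => f r + g r).
Proof.
move=> [[cf f0 incf f00] uf] [[cg g0 incg g00] ug]; split; last first.
  by move=> M; have [r r0 Mr] := uf M; exists r => //; rewrite ltr_wpDr// g0.
split.
- by move=> x; apply: cvgD; [exact: cf|exact: cg].
- by move=> r r0; rewrite addr_ge0 ?f0 ?g0.
- by move=> r s r0 rs; rewrite ltrD ?incf ?incg.
- by rewrite f00 g00 addr0.
Qed.

Lemma class_Koo_comp f g : class_Koo f -> class_Koo g -> class_Koo (f \o g).
Proof.
move=> [kf uf] [[cg g0 incg g00] ug]; have [cf f0 incf f00] := kf.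
split; last first.
  move=> M; have [s s0 Ms] := uf M; have [r r0 sr] := ug s.
  by exists r => //=; rewrite (lt_le_trans Ms)// class_K_le// ltW.
split.
- apply: (continuous_within_comp cg _ cf) => x /=.
  by rewrite !in_itv/= !andbT; exact: g0.
- by move=> r r0 /=; rewrite f0// g0.
- by move=> r s r0 rs /=; rewrite incf ?g0// incg.
- by rewrite /= g00.
Qed.

(** [G] is the infimal convolution of [f] with [x |-> max 0 (- x)].  It is
    1-Lipschitz, as an infimum of 1-Lipschitz functions; and a point [s] beyond
    [x + 1] contributes at least [1], hence no less than [f (x + 1)]. *)
Lemma continuous_nonincreasing_approx f :
  (forall x y, x <= y -> f y <= f x) -> (forall x, 0 <= f x <= 1) ->
  exists G : R -> R, [/\ continuous G, forall x y, x <= y -> G y <= G x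
    & forall x, f (x + 1) <= G x <= f x].
Proof.
move=> decf f01.
have f0 x : 0 <= f x by have /andP[] := f01 x.
have f1 x : f x <= 1 by have /andP[] := f01 x.
pose A x := [set f s + Num.max 0 (s - x) | s in [set: R]].
have Ax x : A x (f x + Num.max 0 (x - x)) by exists x.
have lbA x : lbound (A x) 0.
  by move=> _ [s _ <-]; rewrite addr_ge0// le_max lexx.
pose G x := inf (A x).
have Gle x s : G x <= f s + Num.max 0 (s - x).
  by apply: ge_inf; [exists 0; exact: lbA|exists s].
have leG x c : (forall s, c <= f s + Num.max 0 (s - x)) -> c <= G x.
  by move=> cA; apply: lb_le_inf; [exists (f x + Num.max 0 (x - x))|
     move=> _ [s _ <-]].
have Gdec x y : x <= y -> G y <= G x.
  move=> xy; apply: leG => s; apply: le_trans (Gle y s) _.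
  by rewrite lerD2l ge_max !le_max lexx/=; apply/orP; right; lra.
have Glip x y : x <= y -> G x <= G y + (y - x).
  move=> xy; rewrite -lerBlDr; apply: leG => s; rewrite lerBlDr.
  apply: le_trans (Gle x s) _; rewrite -addrA lerD2l.
  rewrite -lerBlDr; case: (leP 0 (s - x)) => ?; rewrite le_max; apply/orP.
    by right; lra.
  by left; lra.
exists G; split => // [x|x].
  apply/cvgrPdist_le => e e0; near=> y.
  apply: (@le_trans _ _ `|x - y|); last first.
    by near: y; exact: cvgr_dist_le.
  have [xy|/ltW yx] := leP x y.
    rewrite ger0_norm ?subr_ge0 ?Gdec// ler0_norm ?subr_le0//.
    by have := Glip _ _ xy; lra.
  rewrite distrC ger0_norm ?subr_ge0 ?Gdec// ger0_norm ?subr_ge0//.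
  by have := Glip _ _ yx; lra.
apply/andP; split; last first.
  by apply: le_trans (Gle x x) _; rewrite subrr maxxx addr0.
apply: leG => s; have [sx|/ltW sx] := leP s (x + 1).
  by rewrite (le_trans (decf _ _ sx))// lerDl le_max lexx.
apply: le_trans (f1 _) _; rewrite -[leLHS]add0r lerD// le_max.
by apply/orP; right; lra.
Unshelve. all: by end_near. Qed.

(** [Q r t y] says that the value [y] occurs at radius [r] and time [t].  The
    weight [w r = (1 + r) (1 + gamma r)] exceeds [gamma r] by the factor
    [1 + r]: so [y / w r] is small for large [r] because [y <= gamma r], and
    for bounded [r] and large [t] by the hypothesis of uniform decay.  Its
    supremum [sigma t] over all [r] and later times thus tends to [0], and
    [y <= w r * sigma t].  To have a majorant that also vanishes at [r = 0],
    this bound is multiplied with [y <= gamma r] and the square root is taken.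
    The result separates the variables, whence joint continuity. *)
Lemma KL_majorant gamma (Q : R -> R -> R -> Prop) : class_K gamma ->
  (forall r t y, Q r t y -> [/\ 0 <= r, 0 <= t & y <= gamma r]) ->
  (forall eps r, 0 < eps -> 0 < r -> exists tau, forall rho t y,
     Q rho t y -> rho <= r -> tau <= t -> y <= eps) ->
  exists2 kappa, class_KL kappa & forall r t y, Q r t y -> y <= kappa r t.
Proof.
move=> kg Qb Qlim; have [cg g0 incg g00] := kg.
pose w r := (1 + r) * (1 + gamma r).
have w_ge r : 0 <= r -> [/\ 1 <= w r, 1 + r <= w r & (1 + r) * gamma r <= w r].
  move=> r0; have gr := g0 _ r0; rewrite /w.
  have : 0 <= r * gamma r by exact: mulr_ge0.
  by split; lra.
(* The value 0 makes [sigma t] nonnegative, and defined when no [s >= t]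
   occurs. *)
pose A t := [set z | z = 0 \/ exists r s y, [/\ Q r s y, t <= s & z = y / w r]].
have A0 t : A t 0 by left.
have ubA t : ubound (A t) 1.
  move=> z [->//|[r [s [y [Qy _ ->]]]]]; have [r0 _ yg] := Qb _ _ _ Qy.
  have [w1 _ wg] := w_ge _ r0; rewrite ler_pdivrMr ?(lt_le_trans ltr01)// mul1r.
  apply: le_trans yg (le_trans _ wg).
  by rewrite ler_peMl ?g0// lerDl.
have supA t : has_sup (A t) by split; [exists 0|exists 1].
pose sigma t := sup (A t).
have le_sigma t z : A t z -> z <= sigma t.
  by move=> ?; apply: ub_le_sup => //; exact: (supA t).2.
have sigma_le t c : ubound (A t) c -> sigma t <= c.
  by move=> ?; apply: ge_sup => //; exact: (supA t).1.
have [G [cG decG Gb]] : exists G : R -> R, [/\ continuous G,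
    forall x y, x <= y -> G y <= G x
  & forall x, sigma (x + 1) <= G x <= sigma x].
  apply: continuous_nonincreasing_approx => [x y xy|x]; last first.
    by rewrite le_sigma// sigma_le.
  apply: sigma_le => z [->|[r [s [v [Qv ys ->]]]]]; first exact: le_sigma.
  apply: le_sigma; right; exists r, s, v; split => //; exact: le_trans ys.
have sigma_cvg eps : 0 < eps -> exists tau, forall t, tau <= t ->
    sigma t <= eps.
  move=> e0; have r10 : 0 < eps^-1 by rewrite invr_gt0.
  have [tau htau] := Qlim _ _ e0 r10; exists tau => t tt.
  apply: sigma_le => z [->|[r [s [y [Qy ts ->]]]]]; first exact: ltW.
  have [r0 _ yg] := Qb _ _ _ Qy; have [w1 _ wg] := w_ge _ r0.
  rewrite ler_pdivrMr ?(lt_le_trans ltr01)//.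
  (* Beyond the radius [eps^-1] the factor [1 + r] alone gives the bound. *)
  have [rr1|/ltW r1r] := leP r eps^-1.
    rewrite (le_trans (htau _ _ _ Qy rr1 (le_trans tt ts)))//.
    by rewrite ler_peMr// ltW.
  apply: le_trans yg (le_trans _ (ler_wpM2l (ltW e0) wg)).
  rewrite mulrA ler_peMl ?g0//.
  by have := ler_wpM2l (ltW e0) r1r; rewrite mulfV ?gt_eqF//; lra.
(* The shift by 1 makes [G] a majorant of [sigma]; the exponential makes the
   decrease strict. *)
pose Sigma t := G (t - 1) + expR (- t).
have le_Sigma t : sigma t <= Sigma t.
  rewrite /Sigma; have := Gb (t - 1); rewrite subrK => /andP[h _].
  by rewrite (le_trans h)// lerDl expR_ge0.
have sigma0 t : 0 <= sigma t by exact: le_sigma.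
have Sigma_gt0 t : 0 < Sigma t.
  rewrite /Sigma; have := Gb (t - 1) => /andP[h _].
  by rewrite ltr_wpDl ?expR_gt0// (le_trans _ h).
have cSigma : continuous Sigma.
  move=> t; apply: cvgD.
    apply: (cvg_comp (fun t => t - 1) G _ (cG (t - 1))).
    by apply: cvgB; [exact: cvg_id|exact: cvg_cst].
  apply: (cvg_comp -%R expR _ (@continuous_expR R (- t))).
  by apply: cvgN; exact: cvg_id.
have Sigma_decr s t : s < t -> Sigma t < Sigma s.
  by move=> st; rewrite ler_ltD ?ltr_expR ?ltrN2// decG// lerD2r ltW.
have Sigma_cvg : Sigma t @[t --> +oo] --> 0.
  rewrite -[X in _ --> X](addr0 0); apply: cvgD; last exact: cvgr_expR.
  apply/cvgr0Pnorm_le => e e0; have [tau htau] := sigma_cvg _ e0.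
  near=> t; have := Gb (t - 1) => /andP[h h'].
  rewrite ger0_norm ?(le_trans _ h)//; apply: le_trans h' (htau _ _).
  by rewrite lerBrDr; near: t; apply: nbhs_pinfty_ge; exact: num_real.
pose B r := gamma r * w r.
have incB r s : 0 <= r -> r < s -> B r < B s.
  move=> r0 rs; have grs := incg _ _ r0 rs; have gr := g0 _ r0.
  have [w1 _ _] := w_ge _ r0.
  rewrite /B; apply: ltr_pM => //.
    exact: le_trans w1.
  by rewrite /w; apply: ltr_pM; lra.
have B0 r : 0 <= r -> 0 <= B r.
  move=> r0; rewrite mulr_ge0 ?g0//.
  by have [/(le_trans ler01)] := w_ge _ r0.
have c1 : {within `[0, +oo[, continuous (fun r : R => 1 + r)}.
  apply: continuous_subspaceT => r.
  by apply: cvgD; [exact: cvg_cst|exact: cvg_id].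
have cB : {within `[0, +oo[, continuous B}.
  move=> x; apply: cvgM; first exact: cg.
  apply: cvgM; first exact: c1.
  by apply: cvgD; [exact: cvg_cst|exact: cg].
exists (fun r t => Num.sqrt (B r * Sigma t)); last first.
  move=> r t y Qy; have [r0 t0 yg] := Qb _ _ _ Qy.
  have [/ltW y0|y0] := ltP y 0; first by rewrite (le_trans y0)// sqrtr_ge0.
  rewrite -[leLHS](ger0_norm y0) -sqrtr_sqr ler_wsqrtr//.
  have [w1 _ _] := w_ge _ r0; have w0 : 0 < w r by exact: lt_le_trans w1.
  rewrite expr2 /B -mulrA ler_pM// mulrC -ler_pdivrMr//.
  by apply: le_trans (le_Sigma t); apply: le_sigma; right; exists r, t, y.
have BS0 r t : 0 < r -> 0 < B r * Sigma t.
  by move=> r0; rewrite mulr_gt0// (le_lt_trans (B0 0 _) (incB _ _ _ r0)).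
have csqrt (Y : topologicalType) (D : set Y) (f : Y -> R) :
    {within D, continuous f} -> {within D, continuous (Num.sqrt \o f)}.
  by apply: within_continuous_comp => z _; exact: sqrt_continuous.
split.
- apply: (csqrt _ _ (fun p : R * R => B p.1 * Sigma p.2)) => p.
  have cB1 : {within `[0, +oo[ `*` `[0, +oo[, continuous (B \o @fst R R)}.
    have cfst : {within `[0, +oo[ `*` `[0, +oo[, continuous (@fst R R)}.
      by apply: continuous_subspaceT => q; exact: cvg_fst.
    by apply: (continuous_within_comp cfst _ cB) => q [].
  have cS2 : {within `[0, +oo[ `*` `[0, +oo[, continuous (Sigma \o @snd R R)}.
    apply: continuous_subspaceT => q.
    by apply: continuous_comp; [exact: cvg_snd|exact: cSigma].
  by apply: cvgM; [exact: cB1|exact: cS2].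
- move=> t t0; split.
  + apply: (csqrt _ _ (fun r => B r * Sigma t)) => r.
    by apply: cvgM; [exact: cB|exact: cvg_cst].
  + by move=> r r0; rewrite sqrtr_ge0.
  + move=> r s r0 rs; rewrite ltr_sqrt ?BS0 ?(le_lt_trans r0)//.
    by rewrite ltr_pM2r// incB.
  + by rewrite /B g00 !mul0r sqrtr0.
- move=> r r0; split.
  + apply: (csqrt _ _ (fun t => B r * Sigma t)).
    apply: continuous_subspaceT => t.
    by apply: cvgM; [exact: cvg_cst|exact: cSigma].
  + by move=> t t0; rewrite sqrtr_ge0.
  + move=> s t s0 st; rewrite ltr_sqrt ?BS0// ltr_pM2l ?Sigma_decr//.
    by rewrite (le_lt_trans (B0 0 _) (incB _ _ _ r0)).
  + rewrite -[X in _ --> X](@sqrtr0 R) -(mulr0 (B r)).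
    apply: (cvg_comp (fun t => B r * Sigma t) Num.sqrt _
      (@sqrt_continuous R _)).
    by apply: cvgM; [exact: cvg_cst|exact: Sigma_cvg].
Unshelve. all: by end_near. Qed.
End comparison.

(** * Trajectories *)

Section system.
Variables (R : realType) (X U : completeNormedModType R) (V : normedModType R).
Variables (rep : V -> R -> U) (T : R -> {linear X -> X}).
Variables (DA : set X) (A : X -> X) (F : X * U -> X).
Hypothesis hV : input_space rep.
Hypothesis hT : C0_semigroup T.

Lemma phi_mild_solution x0 u : forward_complete rep T F ->
  mild_solution rep T F x0 u (fun t => phi rep T F t x0 u).
Proof.
move=> /(_ x0 u)[[x xsol] _].
by have := @xgetPex _ (fun=> 0) [set x | mild_solution rep T F x0 u x]
  (ex_intro _ x xsol).
Qed.

(** The shifted input [v] only agrees almost everywhere with the translate of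
    [u], which the integral does not notice. *)
Lemma phi_cocycle x0 u t0 : forward_complete rep T F -> 0 <= t0 ->
  exists2 v : V, `|v| <= `|u| & forall t, 0 <= t ->
    phi rep T F (t + t0) x0 u = phi rep T F t (phi rep T F t0 x0 u) v.
Proof.
move=> fc t00; have [v vu nv] := rep_shift hV u t00; exists v => // t t_ge0.
have [_ uniq] := fc (phi rep T F t0 x0 u) v.
exact: uniq (mild_solution_shift hT t00 vu (phi_mild_solution x0 u fc))
  (phi_mild_solution _ v fc) _ t_ge0.
Qed.

Lemma ISS_limit_property : semi_uniformly_ISS rep T DA A F ->
  semi_uniform_limit_property rep T DA A F.
Proof.
move=> [[fc _] [kappa [mu [[_ kK kL] kmu le_phi]]]]; split => //.
exists mu => // eps r eps0 r0; have [_ k0 _ kcvg] := kL _ r0.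
near +oo_R => t.
have t0 : 0 <= t by near: t; apply: nbhs_pinfty_ge; exact: num_real.
have kt : kappa r t <= eps.
  rewrite (le_trans (ler_norm _))//; near: t.
  by move/cvgr0Pnorm_le : kcvg; apply.
exists t => x0 u Dx0 x0r; exists t; split => //.
apply: le_trans (le_phi _ u _ Dx0 t0) _; rewrite lerD2r (le_trans _ kt)//.
by apply: class_K_le (kK _ t0) _ x0r; rewrite addr_ge0.
Unshelve. all: by end_near. Qed.

(** The limit property is used with [d / 2], where [gamma d <= eps].  According
    to whether [mu `|u|] is below or above [d / 2], the bound
    [gamma (d / 2 + mu `|u|)] is at most [gamma d] or [gamma (2 mu `|u|)]. *)
Lemma limit_property_asymptotic_gain : UGS rep T F ->
  semi_uniform_limit_property rep T DA A F ->
  semi_uniform_asymptotic_gain_property rep T DA A F.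
Proof.
move=> [fc [gamma [mu' [kgamma kmu' ugs]]]] [_ [mu kmu lim]]; split => //.
have [Kgamma _] := kgamma; have [[_ mu0 _ _] _] := kmu.
exists (fun r => (gamma \o (fun r => mu r + mu r)) r + mu' r).
  apply: class_Koo_add => //; apply: class_Koo_comp => //.
  exact: class_Koo_add.
move=> eps r eps0 r0; have [d d0 gd] := class_K_small Kgamma eps0.
have d20 : 0 < d / 2 by rewrite divr_gt0.
have [tau htau] := lim _ _ d20 r0.
exists tau => x0 u Dx0 x0r t t_ge0 tau_t.
have [s [s0 s_tau phis]] := htau _ u Dx0 x0r.
have [v vu cocycle] := phi_cocycle x0 u fc s0.
have ts : 0 <= t - s by rewrite subr_ge0 (le_trans s_tau).
rewrite -(subrK s t) cocycle//; apply: le_trans (ugs _ _ _ ts) _.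
rewrite addrA lerD//; last exact: class_K_le kmu'.1 _ _.
have m0 := mu0 _ (normr_ge0 u).
have [dm|/ltW md] := leP (mu `|u|) (d / 2).
  rewrite (le_trans (class_K_le Kgamma _ (_ : _ <= d)))//.
    by apply: le_trans phis _; lra.
  have [[_ g0 _ _] _] := kgamma.
  by rewrite (le_trans gd)//= lerDl g0// addr_ge0.
rewrite (le_trans (class_K_le Kgamma _ (_ : _ <= mu `|u| + mu `|u|)))//.
  by apply: le_trans phis _; lra.
by rewrite /= lerDr ltW.
Qed.

(** The gain [m] dominates both the gain of the stability estimate, which bounds
    the excess [y] by [gamma r], and the asymptotic gain, which makes it decay;
    [KL_majorant] then applies to [y]. *)
Lemma asymptotic_gain_ISS : UGS rep T F ->
  semi_uniform_asymptotic_gain_property rep T DA A F ->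
  semi_uniformly_ISS rep T DA A F.
Proof.
move=> ugs_; have [fc [gamma [mu' [kgamma kmu' ugs]]]] := ugs_.
move=> [_ [mu kmu ag]]; split => //.
have [Kgamma _] := kgamma.
have [[_ mu0 _ _] _] := kmu; have [[_ mu'0 _ _] _] := kmu'.
pose m r := mu r + mu' r.
pose Q r t y := exists x0 u, [/\ DA x0, 0 <= t, graph_norm A x0 = r &
  `|phi rep T F t x0 u| = y + m `|u|].
have [||kappa kl_kappa Qkappa] := @KL_majorant R gamma Q Kgamma.
- move=> r t y [x0 [u [Dx0 t0 <- phiE]]]; split => //; first exact: addr_ge0.
  have := ugs x0 u t t0; rewrite phiE /m.
  have : gamma `|x0| <= gamma (graph_norm A x0).
    by apply: class_K_le => //; rewrite lerDl.
  by have := mu0 _ (normr_ge0 u); lra.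
- move=> eps r eps0 r0; have [tau htau] := ag _ _ eps0 r0; exists tau.
  move=> rho t y [x0 [u [Dx0 t0 <- phiE]]] x0r tau_t.
  have := htau _ u Dx0 x0r _ t0 tau_t; rewrite phiE /m.
  by have := mu'0 _ (normr_ge0 u); lra.
exists kappa, m; split => //; first exact: class_Koo_add.
move=> x0 u t Dx0 t0; rewrite -lerBlDr; apply: Qkappa.
by exists x0, u; split => //; rewrite subrK.
Qed.

End system.

(** * Equivalence of the three properties *)

Unset Implicit Arguments.

Theorem theorem3p9 (R : realType) (X U : completeNormedModType R)
    (V : normedModType R) (rep : V -> R -> U)
    (T : R -> {linear X -> X}) (DA : set X) (A : X -> X) (F : X * U -> X)
    (hV : input_space rep)
    (hT : C0_semigroup T)
    (hA : generates DA A T)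
    (hF : admissible_nonlinearity rep F) :
  [<-> semi_uniformly_ISS rep T DA A F;
       UGS rep T F /\ semi_uniform_limit_property rep T DA A F;
       UGS rep T F /\ semi_uniform_asymptotic_gain_property rep T DA A F].
Proof.
tfae.
- by move=> iss; split; [exact: iss.1|exact: ISS_limit_property].
- by move=> [ugs lim]; split => //; exact: limit_property_asymptotic_gain.
- by move=> [ugs ag]; exact: asymptotic_gain_ISS.
Qed.
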